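(* Let $h:\mathbb{C}^2\times\mathbb{C}^2\to\mathbb{C}$ be a Hermitian form and let $H=\operatorname{Im} h$. (i) For every vertex of the Apollonian kingdom, labelled by a lax lattice $\{L,iL\}$, the number $H(a,b)$ is the same for every ordered $\mathbb{Z}$-basis $(a,b)$ of $L$ or of $iL$ compatible with the orientation; call it $H$ of the vertex. (ii) If two chambers of the Apollonian kingdom share a wall, with common vertices $x_1,x_2,x_3$ and non-common vertices $y_1,y_2$, then $H(y_1)+H(y_2)=2\bigl(H(x_1)+H(x_2)+H(x_3)\bigr)$.
   Context: A Hermitian form on $\mathbb{C}^2$ is a map $h$ with $h(au+v,w)=ah(u,w)+h(v,w)$, $h(u,av+w)=\bar a h(u,v)+h(u,w)$ and $h(u,v)=\overline{h(v,u)}$ for all $u,v,w\in\mathbb{C}^2$, $a\in\mathbb{C}$. Units of $\mathbb{Z}[i]$ are $\{\pm1,\pm i\}$. A lax vector is a primitive vector of $\mathbb{Z}[i]^2$ (coprime entries) up to multiplication by units. A basis is a pair of lax vectors whose representatives form a $\mathbb{Z}[i]$-basis of $\mathbb{Z}[i]^2$; a superbasis is a triple of lax vectors any two of which form a basis. An ultrabasis is a set of six lax vectors $u,v,w,x,y,z$ such that $\{u,v,w\},\{u,y,z\},\{v,x,z\},\{w,x,y\}$ are superbases; it is regarded as a chamber: a tetrahedron whose edges are labelled by the six lax vectors so that its four triangular faces (walls) carry these four superbases. Every superbasis has representatives $u,v,w$ with $u+v+w=0$, and the chambers containing it as a wall are exactly the left standard chamber (edges $u,v,w,u+iv,v+iw,w+iu$;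 walls $\{u,v,w\},\{u,u+iv,w+iu\},\{v,v+iw,u+iv\},\{w,w+iu,v+iw\}$) and the right standard chamber (edges $u,v,w,u-iv,v-iw,w-iu$; walls $\{u,v,w\},\{u,u-iv,w-iu\},\{v,v-iw,u-iv\},\{w,w-iu,v-iw\}$). The Apollonian kingdom is the graph obtained from all chambers by gluing along common walls (matching labels). Lax lattices: for an ordered $\mathbb{Z}[i]$-basis $(a,b)$ of $\mathbb{Z}[i]^2$, $L=\mathbb{Z}a+\mathbb{Z}b$ oriented by $(a,b)$ (determinant $1$ changes of $\mathbb{Z}$-basis preserve orientation, determinant $-1$ reverse it); the lax lattice with ordered basis $(a,b)$ is $\{L,iL\}$ with $iL$ oriented by $(ia,ib)$. Vertex labels: in a left standard chamber with $u+v+w=0$, the vertex at edges $u,v,u+iv$ carries $(u,iv)$; at $v,w,v+iw$ carries $(v,iw)$; at $w,u,w+iu$ carries $(w,iu)$; at $u+iv,v+iw,w+iu$ carries $(w-iv,iu-v)$. In the right standard chamber the three vertices of wall $\{u,v,w\}$ carry the same labels and the vertex at $u-iv,v-iw,w-iu$ carries $(w+iv,iu+v)$. (These labels are independent of the choices made.) *)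

(* Defs.v *)
From HB Require Import structures.
From mathcomp Require Import all_boot all_order all_algebra.
From mathcomp Require Import all_classical reals.
From mathcomp Require Import complex.
From Stdlib Require Import Relation_Operators.

Set Implicit Arguments.
Unset Strict Implicit.
Unset Printing Implicit Defensive.

Import Order.TTheory GRing.Theory Num.Theory.

Local Open Scope classical_set_scope.
Local Open Scope ring_scope.

Definition C2 (R : realType) : Type := 'rV[R[i]]_2.

Definition hermitian_form {R : realType} (h : C2 R -> C2 R -> R[i]) : Prop :=
  [/\ forall (a : R[i]) (u v w : C2 R), h (a *: u + v) w = a * h u w + h v w,
      forall (a : R[i]) (u v w : C2 R), h u (a *: v + w) = a^* * h u v + h u w
    & forall u v : C2 R, h u v = (h v u)^*].

Definition gaussint {R : realType} : set R[i] :=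
  [set z | exists m n : int, z = Complex m%:~R n%:~R].

Definition gaussunit {R : realType} : set R[i] := [set 1; -1; 'i; - 'i].

Definition gaussdvd {R : realType} (d z : R[i]) : Prop :=
  exists2 q : R[i], gaussint q & z = d * q.

Definition gaussvec {R : realType} : set (C2 R) :=
  [set v | forall j : 'I_2, gaussint (v 0 j)].

Definition primitive {R : realType} (v : C2 R) : Prop :=
  gaussvec v /\
  forall d : R[i], gaussint d -> (forall j : 'I_2, gaussdvd d (v 0 j)) ->
    gaussunit d.

(* A lax vector is represented by its class under multiplication by units. *)
Definition laxclass (R : realType) : Type := set (C2 R).

Definition lax {R : realType} (v : C2 R) : laxclass R :=
  [set e *: v | e in gaussunit].

Definition lax_vector {R : realType} (l : laxclass R) : Prop :=
  exists2 v : C2 R, primitive v & l = lax v.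

Definition gauss_basis {R : realType} (a b : C2 R) : Prop :=
  [/\ gaussvec a, gaussvec b,
      forall v : C2 R, gaussvec v ->
        exists s t : R[i], [/\ gaussint s, gaussint t & v = s *: a + t *: b]
    & forall s t : R[i], gaussint s -> gaussint t ->
        s *: a + t *: b = 0 -> s = 0 /\ t = 0].

Definition lax_basis {R : realType} (l m : laxclass R) : Prop :=
  [/\ lax_vector l, lax_vector m
    & exists a b : C2 R, [/\ l a, m b & gauss_basis a b]].

Definition superbasis {R : realType} (u v w : laxclass R) : Prop :=
  [/\ lax_basis u v, lax_basis v w & lax_basis w u].

(* The six lax vectors have to be distinct: otherwise u = x, v = y, w = z, for
   instance, would satisfy the four superbasis conditions. *)
Definition ultrabasis {R : realType} (u v w x y z : laxclass R) : Prop :=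
  uniq [:: u; v; w; x; y; z] /\
  [/\ superbasis u v w, superbasis u y z, superbasis v x z & superbasis w x y].

(* A wall is the set of its three edge labels.  As the six edges of a chamber
   have distinct labels, the labelled tetrahedron is encoded by the set of its
   four walls, and a vertex of it by the set of the labels of the three edges
   through it, that is, the edges outside the opposite wall.  (The set of the
   six labels alone does not suffice: the triples of edges through a vertex are
   superbases too, and taking them as walls gives another chamber with the same
   six labels.) *)
Definition wallset (R : realType) : Type := set (laxclass R).
Definition chamberset (R : realType) : Type := set (wallset R).
Definition cornerset (R : realType) : Type := set (laxclass R).

Definition tetrahedron {R : realType} (u v w x y z : laxclass R) :
    chamberset R :=
  [set [set u; v; w]; [set u; y; z]; [set v; x; z]; [set w; x; y]].

Definition chamber {R : realType} (C : chamberset R) : Prop :=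
  exists u v w x y z : laxclass R,
    ultrabasis u v w x y z /\ C = tetrahedron u v w x y z.

Definition edges {R : realType} (C : chamberset R) : set (laxclass R) :=
  \bigcup_(W in C) W.

Definition corner {R : realType} (C : chamberset R) (V : cornerset R) : Prop :=
  exists2 W : wallset R, C W & V = edges C `\` W.

(* A vertex of a chamber is opposite to a wall when no edge through it lies on
   the wall; otherwise it is a vertex of the wall, and exactly two of the edges
   through it lie on the wall. *)
Definition on_wall {R : realType} (V : cornerset R) (W : wallset R) : Prop :=
  V `&` W !=set0.

(* Gluing along a common wall W identifies the vertices of W that lie on the
   same two (labelled) edges of W. *)
Definition glued {R : realType} (p q : chamberset R * cornerset R) : Prop :=
  [/\ chamber p.1, chamber q.1, corner p.1 p.2, corner q.1 q.2
    & exists W : wallset R,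
        [/\ p.1 W, q.1 W, on_wall p.2 W & p.2 `&` W = q.2 `&` W]].

Definition kingdom_point (R : realType) : Type :=
  set (chamberset R * cornerset R).

Definition point_of {R : realType} (C : chamberset R) (V : cornerset R) :
    kingdom_point R :=
  [set q | clos_refl_sym_trans _ glued (C, V) q].

Definition kingdom_vertex {R : realType} (X : kingdom_point R) : Prop :=
  exists (C : chamberset R) (V : cornerset R),
    [/\ chamber C, corner C V & X = point_of C V].

Definition zspan {R : realType} (a b : C2 R) : set (C2 R) :=
  [set v | exists m n : int, v = a *~ m + b *~ n].

Definition zbasis {R : realType} (L : set (C2 R)) (a b : C2 R) : Prop :=
  L = zspan a b /\
  forall m n : int, a *~ m + b *~ n = 0 -> m = 0 /\ n = 0.

(* An oriented lattice: the lattice, and its positively oriented bases. *)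
Definition olattice (R : realType) : Type := set (C2 R) * set (C2 R * C2 R).

Definition oriented_by {R : realType} (a b : C2 R) : olattice R :=
  (zspan a b,
   [set ab | zbasis (zspan a b) ab.1 ab.2 /\
      exists p q r s : int,
        [/\ p * s - q * r = 1,
            ab.1 = a *~ p + b *~ q & ab.2 = a *~ r + b *~ s]]).

Definition laxlattice (R : realType) : Type := set (olattice R).

Definition lax_lattice {R : realType} (a b : C2 R) : laxlattice R :=
  [set oriented_by a b; oriented_by ('i *: a) ('i *: b)].

Definition compatible {R : realType} (Lam : laxlattice R) (a b : C2 R) : Prop :=
  exists2 o : olattice R, Lam o & o.2 (a, b).

Definition left_standard {R : realType} (u v w : C2 R) : chamberset R :=
  tetrahedron (lax u) (lax v) (lax w)
    (lax (v + 'i *: w)) (lax (w + 'i *: u)) (lax (u + 'i *: v)).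

Definition right_standard {R : realType} (u v w : C2 R) : chamberset R :=
  tetrahedron (lax u) (lax v) (lax w)
    (lax (v - 'i *: w)) (lax (w - 'i *: u)) (lax (u - 'i *: v)).

Definition zero_sum_superbasis {R : realType} (u v w : C2 R) : Prop :=
  superbasis (lax u) (lax v) (lax w) /\ u + v + w = 0.

Inductive corner_label {R : realType} :
    chamberset R -> cornerset R -> laxlattice R -> Prop :=
| left_uv (u v w : C2 R) of zero_sum_superbasis u v w :
    corner_label (left_standard u v w)
      [set lax u; lax v; lax (u + 'i *: v)] (lax_lattice u ('i *: v))
| left_vw (u v w : C2 R) of zero_sum_superbasis u v w :
    corner_label (left_standard u v w)
      [set lax v; lax w; lax (v + 'i *: w)] (lax_lattice v ('i *: w))
| left_wu (u v w : C2 R) of zero_sum_superbasis u v w :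
    corner_label (left_standard u v w)
      [set lax w; lax u; lax (w + 'i *: u)] (lax_lattice w ('i *: u))
| left_apex (u v w : C2 R) of zero_sum_superbasis u v w :
    corner_label (left_standard u v w)
      [set lax (u + 'i *: v); lax (v + 'i *: w); lax (w + 'i *: u)]
      (lax_lattice (w - 'i *: v) ('i *: u - v))
| right_uv (u v w : C2 R) of zero_sum_superbasis u v w :
    corner_label (right_standard u v w)
      [set lax u; lax v; lax (u - 'i *: v)] (lax_lattice u ('i *: v))
| right_vw (u v w : C2 R) of zero_sum_superbasis u v w :
    corner_label (right_standard u v w)
      [set lax v; lax w; lax (v - 'i *: w)] (lax_lattice v ('i *: w))
| right_wu (u v w : C2 R) of zero_sum_superbasis u v w :
    corner_label (right_standard u v w)
      [set lax w; lax u; lax (w - 'i *: u)] (lax_lattice w ('i *: u))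
| right_apex (u v w : C2 R) of zero_sum_superbasis u v w :
    corner_label (right_standard u v w)
      [set lax (u - 'i *: v); lax (v - 'i *: w); lax (w - 'i *: u)]
      (lax_lattice (w + 'i *: v) ('i *: u + v)).

Definition vertex_label {R : realType} (X : kingdom_point R)
    (Lam : laxlattice R) : Prop :=
  exists (C : chamberset R) (V : cornerset R),
    X (C, V) /\ corner_label C V Lam.

Definition imform {R : realType} (h : C2 R -> C2 R -> R[i]) (a b : C2 R) : R :=
  complex.Im (h a b).

Definition vertex_value {R : realType} (h : C2 R -> C2 R -> R[i])
    (X : kingdom_point R) (r : R) : Prop :=
  forall (Lam : laxlattice R) (a b : C2 R),
    vertex_label X Lam -> compatible Lam a b -> imform h a b = r.

Definition Hvertex {R : realType} (h : C2 R -> C2 R -> R[i])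
    (X : kingdom_point R) : R :=
  xget 0 [set r | vertex_value h X r].

(* Main.v *)
Require Import Defs.
From HB Require Import structures.
From mathcomp Require Import all_boot all_order all_algebra.
From mathcomp Require Import all_classical reals.
From mathcomp Require Import complex.
From mathcomp Require Import zify ring lra.
From Stdlib Require Import Relation_Operators.

Import Order.TTheory GRing.Theory Num.Theory.

Local Open Scope classical_set_scope.
Local Open Scope ring_scope.

(* Put q(v) = h(v, v), a function of the lax vector v.  If u + v + w = 0, then
   H(u, iv) = - Re h(u, v) = (q(u) + q(v) - q(w)) / 2, so H of a vertex can be
   read off from any wall through it, and this is compatible with gluing.  The
   three walls of a chamber through a vertex give the same number because
   q(u) + q(x) is the same for the three pairs of opposite edges u, x: in a
   standard chamber it equals S = q(u) + q(v) + q(w) +- 2 H(u, v), with + for the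
   left one and - for the right one.  A wall with norm sum Q has vertices of
   total H equal to Q / 2, and the vertex opposite to it has H = S - Q / 2;
   adding this over the left and the right chamber gives Q.

   A determinant computation with units of Z[i] shows that every chamber is one
   of the two standard chambers on each of its walls. *)

(** * Units of Z[i], determinants and zero-sum representatives *)

Section GaussianUnits.

Context {R : realType}.
Implicit Types (z e : R[i]) (a b c u v w : C2 R) (l m n : laxclass R).

Lemma imaginaryE : 'i = Complex 0 1 :> R[i].
Proof. by rewrite -complexiE. Qed.

Lemma mulii : 'i * 'i = -1 :> R[i].
Proof. by rewrite -expr2 sqrCi. Qed.

(** The field norm, taken in [R] so that norm equations between Gaussian integers descend to [int]
    and linear arithmetic applies. *)
Definition normsq z : R := complex.Re z ^+ 2 + complex.Im z ^+ 2.

Lemma normsqM z e : normsq (z * e) = normsq z * normsq e.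
Proof. by case: z => p q; case: e => r s; rewrite /normsq /=; ring. Qed.

Lemma normsq_unit z : gaussunit z -> normsq z = 1.
Proof.
by case=> [[[]|]|] ->; rewrite /normsq ?imaginaryE /=; ring.
Qed.

Lemma gaussint_unit z : gaussint z -> normsq z = 1 -> gaussunit z.
Proof.
move=> [p [q ->]]; rewrite /normsq /= -!rmorphXn -rmorphD => /(@intr_inj R _ 1) H.
(* Over [int], the equation bounds both coordinates by 1 in absolute value, which leaves nine pairs
   to check. *)
have : [\/ p = 1 /\ q = 0, p = -1 /\ q = 0, p = 0 /\ q = 1 | p = 0 /\ q = -1].
  rewrite !expr2 in H.
  have [p1 p2] : -1 <= p /\ p <= 1 by split; nia.
  have [q1 q2] : -1 <= q /\ q <= 1 by split; nia.
  have Hp : p = -1 \/ p = 0 \/ p = 1 by lia.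
  have Hq : q = -1 \/ q = 0 \/ q = 1 by lia.
  case: Hp H => [->|[->|->]]; case: Hq => [->|[->|->]] // _;
  by [apply: Or41|apply: Or42|apply: Or43|apply: Or44].
rewrite /gaussunit /= imaginaryE => -[] [-> ->]; rewrite ?mulr0z ?mulr1z ?mulrN1z.
- by left; left; left.
- by left; left; right; apply/eqP; rewrite eq_complex /= oppr0 !eqxx.
- by left; right.
- by right; apply/eqP; rewrite eq_complex /= oppr0 !eqxx.
Qed.

Lemma gaussintB z e : gaussint z -> gaussint e -> gaussint (z - e).
Proof.
move=> [p [q ->]] [r [s ->]]; exists (p - r), (q - s).
by apply/eqP; rewrite eq_complex /= !rmorphB /= !eqxx.
Qed.

Lemma gaussintM z e : gaussint z -> gaussint e -> gaussint (z * e).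
Proof.
move=> [p [q ->]] [r [s ->]]; exists (p * r - q * s), (p * s + q * r).
by apply/eqP; rewrite eq_complex /= !(rmorphB, rmorphD, rmorphM) /= !eqxx.
Qed.

(** The norms are nonnegative integers with product 1, so both are 1. *)
Lemma gaussint_inv z e : gaussint z -> gaussint e -> z * e = 1 -> gaussunit z.
Proof.
move=> gz ge /(congr1 normsq); rewrite normsqM [RHS]normsq_unit; last by do 3 left.
move=> H; apply: gaussint_unit => //; move: gz ge H => [p [q ->]] [r [s ->]].
rewrite /normsq /= -!rmorphXn -!rmorphD -rmorphM => /(@intr_inj R _ 1) H.
have : 0 <= r ^+ 2 + s ^+ 2 by rewrite addr_ge0 ?sqr_ge0.
have : 0 <= p ^+ 2 + q ^+ 2 by rewrite addr_ge0 ?sqr_ge0.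
move: H; move: (p ^+ 2 + q ^+ 2) (r ^+ 2 + s ^+ 2) => A B H A0 B0.
by have -> : A = 1 by case: A B H A0 B0 => [[|[|A]]|A] [[|B]|B] //; lia.
Qed.

Lemma gaussint_of_unit z : gaussunit z -> gaussint z.
Proof.
case=> [[[]|]|] ->; [exists 1, 0|exists (-1), 0|exists 0, 1|exists 0, (-1)];
by apply/eqP; rewrite ?imaginaryE eq_complex /= ?mulrN1z ?oppr0 !eqxx.
Qed.

Lemma gaussunit1 : gaussunit (1 : R[i]).
Proof. by do 3 left. Qed.

Lemma gaussunitM z e : gaussunit z -> gaussunit e -> gaussunit (z * e).
Proof.
move=> uz ue; apply: gaussint_unit; first by apply: gaussintM; exact: gaussint_of_unit.
by rewrite normsqM !normsq_unit // mulr1.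
Qed.

Lemma gaussunitN z : gaussunit z -> gaussunit (- z).
Proof. by case=> [[[]|]|] ->; rewrite /gaussunit /= ?opprK; tauto. Qed.

Lemma gaussunitV z : gaussunit z -> gaussunit z^-1.
Proof.
case=> [[[]|]|] ->; rewrite /gaussunit /= ?invrN ?invr1 ?invCi ?opprK; tauto.
Qed.

Lemma gaussunit_neq0 z : gaussunit z -> z != 0.
Proof.
move=> /normsq_unit H; apply/eqP => z0; move: H.
by rewrite z0 /normsq /= expr0n addr0 => /eqP; rewrite eq_sym oner_eq0.
Qed.

Definition det2 a b : R[i] := a 0 0 * b 0 1 - a 0 1 * b 0 0.

Lemma row2P (a b : 'rV[R[i]]_2) : a 0 0 = b 0 0 -> a 0 1 = b 0 1 -> a = b.
Proof.
move=> h0 h1; apply/rowP => j.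
by case: j => [[|[|//]]] p;
  [rewrite (_ : Ordinal p = 0)|rewrite (_ : Ordinal p = 1)] => //; apply: val_inj.
Qed.

Lemma det2_comb u v (p q r s : R[i]) :
  det2 (p *: u + q *: v) (r *: u + s *: v) = (p * s - q * r) * det2 u v.
Proof. by rewrite /det2 !mxE; ring. Qed.

Lemma det2C a b : det2 b a = - det2 a b.
Proof. by rewrite /det2; ring. Qed.

Lemma det2Z p q a b : det2 (p *: a) (q *: b) = p * q * det2 a b.
Proof. by rewrite /det2 !mxE; ring. Qed.

Lemma det2aa a : det2 a a = 0.
Proof. by rewrite /det2; ring. Qed.

(** Cramer's rule. *)
Lemma det2_coord u v c : det2 u v != 0 ->
  c = (det2 c v / det2 u v) *: u + (det2 u c / det2 u v) *: v.
Proof.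
by move=> d0; apply: row2P; rewrite /det2 !mxE; field; rewrite -/(det2 u v).
Qed.

(** The two standard vectors are Gaussian combinations of [a] and [b], so [det2 a b] times the
    determinant of the coefficients is 1. *)
Lemma gauss_basis_det a b : gauss_basis a b -> gaussunit (det2 a b).
Proof.
move=> [ga gb gen _].
have gdelta k : gaussvec (delta_mx 0 k : C2 R).
  move=> j; rewrite mxE; case: (_ && _); [exists 1, 0|exists 0, 0] => //.
have [p [q [gp gq e0]]] := gen _ (gdelta 0).
have [r [s [gr gs e1]]] := gen _ (gdelta 1).
have D1 : det2 (delta_mx 0 0) (delta_mx 0 1) = 1 by rewrite /det2 !mxE /=; ring.
rewrite e0 e1 det2_comb mulrC in D1.
apply: gaussint_inv D1; apply: gaussintB; apply: gaussintM => //.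
Qed.

Lemma lax_self a : lax a a.
Proof. by exists 1; [exact: gaussunit1|rewrite scale1r]. Qed.

Lemma laxZ e a : gaussunit e -> lax (e *: a) = lax a.
Proof.
move=> ue; apply/seteqP; split => _ [f uf <-].
  by exists (f * e); [exact: gaussunitM|rewrite scalerA].
exists (f / e); first by apply: gaussunitM => //; exact: gaussunitV.
by rewrite scalerA divfK // gaussunit_neq0.
Qed.

Lemma lax_eqP a b : lax a = lax b -> exists2 e, gaussunit e & a = e *: b.
Proof. by move=> E; have := lax_self a; rewrite E => -[e ? <-]; exists e. Qed.

Lemma lax_neq a b : det2 a b != 0 -> lax a != lax b.
Proof.
move=> d0; apply/eqP => /lax_eqP[e _ E]; move: d0.
by rewrite E -[b in X in det2 _ X]scale1r det2Z det2aa mulr0 eqxx.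
Qed.

(** Changing representatives multiplies the determinant by a unit, so any representatives will
    do. *)
Lemma lax_basis_det a b : lax_basis (lax a) (lax b) -> gaussunit (det2 a b).
Proof.
move=> [_ _ [_ [_ [[e ue <-] [f uf <-] /gauss_basis_det]]]].
rewrite det2Z => H.
have -> : det2 a b = (e * f)^-1 * (e * f * det2 a b).
  by rewrite mulKf // mulf_neq0 // gaussunit_neq0.
by apply: gaussunitM => //; apply/gaussunitV/gaussunitM.
Qed.

Lemma lax_basis_sym l m : lax_basis l m -> lax_basis m l.
Proof.
move=> [ll lm [a [b [la mb [ga gb gen ind]]]]]; split => //.
exists b, a; split => //; split => //.
  by move=> v /gen[s [t [gs gt ->]]]; exists t, s; rewrite addrC.
by move=> s t gs gt; rewrite addrC => /ind[].
Qed.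

Lemma superbasis_rot l m n : superbasis l m n -> superbasis m n l.
Proof. by case. Qed.

Lemma superbasis_swap l m n : superbasis l m n -> superbasis m l n.
Proof. by case=> *; split; apply: lax_basis_sym. Qed.

(** By Cramer's rule [c] is a combination of [a] and [b] whose coefficients are quotients of unit
    determinants. They are units, so they can be absorbed into the representatives. *)
Lemma superbasis_zero_sum l m n : superbasis l m n ->
  exists u v w, [/\ l = lax u, m = lax v, n = lax w & zero_sum_superbasis u v w].
Proof.
move=> sb; have [lm mn nl] := sb.
have [[a _ El] [b _ Em] _] := lm; have [_ [c _ En] _] := mn.
have uab : gaussunit (det2 a b) by apply: lax_basis_det; rewrite -El -Em.
have ubc : gaussunit (det2 b c) by apply: lax_basis_det; rewrite -Em -En.
have uca : gaussunit (det2 c a) by apply: lax_basis_det; rewrite -En -El.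
have Ec := @det2_coord a b c (gaussunit_neq0 _ uab).
have up : gaussunit (det2 c b / det2 a b).
  by rewrite det2C; apply: gaussunitM; [exact: gaussunitN|exact: gaussunitV].
have uq : gaussunit (det2 a c / det2 a b).
  by rewrite det2C; apply: gaussunitM; [exact: gaussunitN|exact: gaussunitV].
exists ((det2 c b / det2 a b) *: a), ((det2 a c / det2 a b) *: b), (-1 *: c).
rewrite !laxZ //; last by apply: gaussunitN; exact: gaussunit1.
split=> //; split; last by rewrite -Ec scaleN1r subrr.
by rewrite !laxZ -?El -?Em -?En //; apply: gaussunitN; exact: gaussunit1.
Qed.

End GaussianUnits.

Lemma uniq3P (T : eqType) (a b c : T) :
  uniq [:: a; b; c] <-> [/\ a <> b, a <> c & b <> c].
Proof.
rewrite /= !inE negb_or andbT; split=> [/andP[/andP[/eqP ? /eqP ?] /eqP ?] //|].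
by move=> [/eqP -> /eqP -> /eqP ->].
Qed.

Lemma uniq6P (T : eqType) (a b c d e f : T) :
  uniq [:: a; b; c; d; e; f] <->
  [/\ [/\ a <> b, a <> c, a <> d, a <> e & a <> f],
      [/\ b <> c, b <> d, b <> e & b <> f],
      [/\ c <> d, c <> e & c <> f], d <> e /\ d <> f & e <> f].
Proof.
rewrite /= !inE !negb_or !andbT -!andbA; split.
  do 14 case/andP => /eqP ?; move=> /eqP ?.
  by do ![split].
move=> [[/eqP-> /eqP-> /eqP-> /eqP-> /eqP->] [/eqP-> /eqP-> /eqP-> /eqP->]].
by move=> [/eqP-> /eqP-> /eqP->] [/eqP-> /eqP->] /eqP->.
Qed.

(** * Classification of the chambers on a wall, and nondegeneracy of the standard ones *)

Section StandardChambers.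

Context {R : realType}.
Implicit Types (a b c u v w : C2 R) (l m n x y z : laxclass R).

Lemma zero_sumE u v w : u + v + w = 0 -> w = - u - v.
Proof. by move/eqP; rewrite addrC addr_eq0 opprD => /eqP. Qed.

(** The finite check behind the classification, for x = u + (1 + e)v, y = (1 + f)u + v and z = u +
    gv. The three exclusions say that x, y, z differ from u, v, w as lax vectors, and the two norm
    equations that x, z and y, z have unit determinant. *)
Lemma unit_triple (e f g : R[i]) :
  gaussunit e -> gaussunit f -> gaussunit g -> e <> -1 -> f <> -1 -> g <> 1 ->
  normsq (1 * g - (1 + e) * 1) = 1 -> normsq ((1 + f) * g - 1 * 1) = 1 ->
  (g = 'i /\ e = 'i /\ f = - 'i) \/ (g = - 'i /\ e = - 'i /\ f = 'i).
Proof.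
move=> ue uf ug eN1 fN1 gN1 Nxz Nyz.
case: ug gN1 Nxz Nyz => [[[->|->]|->]|->] // _;
case: ue eN1 => [[[->|->]|->]|->] // _;
case: uf fN1 => [[[->|->]|->]|->] // _;
rewrite /normsq imaginaryE /= => H1 H2;
by [left|right|exfalso; lra].
Qed.

Lemma ultrabasis_standard u v w x y z : zero_sum_superbasis u v w ->
  ultrabasis (lax u) (lax v) (lax w) x y z ->
  [/\ x = lax (v + 'i *: w), y = lax (w + 'i *: u) & z = lax (u + 'i *: v)] \/
  [/\ x = lax (v - 'i *: w), y = lax (w - 'i *: u) & z = lax (u - 'i *: v)].
Proof.
move=> [[buv _ _] /zero_sumE ->] [un [_ [uy yz zu] [vx xz zv] [wx xy yw]]].
have ud := lax_basis_det _ _ buv.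
have d0 := gaussunit_neq0 _ ud.
have uE : u = 1 *: u + 0 *: v by rewrite scale1r scale0r addr0.
have vE : v = 0 *: u + 1 *: v by rewrite scale1r scale0r add0r.
have wE : - u - v = -1 *: u + -1 *: v by rewrite !scaleN1r.
have unitc (p q r s : R[i]) :
    lax_basis (lax (p *: u + q *: v)) (lax (r *: u + s *: v)) ->
    gaussunit (p * s - q * r).
  move=> /lax_basis_det; rewrite det2_comb -{2}[p * s - q * r](mulfK d0) => U.
  by apply: gaussunitM => //; exact: gaussunitV.
have quot (a b : R[i]) : gaussunit a -> gaussunit b -> gaussunit (b / a).
  by move=> ua ub; apply: gaussunitM => //; exact: gaussunitV.
(* For x = pu + qv, the bases v, x and w, x make p and q - p units; dividing by p gives e = (q - p)
   / p. *)
have [e ue Ex] : exists2 e, gaussunit e & x = lax (1 *: u + (1 + e) *: v).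
  have [[x0 _ Ex] _ _] := xy; rewrite Ex (det2_coord u v x0 d0) in vx wx *.
  move: (_ / _) (det2 u x0 / _) vx wx => p q; rewrite {}wE => vx /unitc uq.
  have up : gaussunit (0 * q - 1 * p) by apply: unitc; rewrite -vE.
  have {}up : gaussunit p by move/gaussunitN: up; rewrite mul0r mul1r sub0r opprK.
  exists ((-1 * q - -1 * p) / - p); first by apply: quot => //; exact: gaussunitN.
  rewrite -[in LHS](laxZ p^-1); last exact: gaussunitV.
  congr lax; rewrite scalerDr !scalerA mulVf ?gaussunit_neq0 //; congr (_ + _ *: _).
  by field; exact: gaussunit_neq0.
(* Likewise q and p - q are units for y, and f = (p - q) / q. *)
have [f uf Ey] : exists2 f, gaussunit f & y = lax ((1 + f) *: u + 1 *: v).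
  have [[y0 _ Ey] _ _] := yz; rewrite Ey (det2_coord u v y0 d0) in uy yw *.
  move: (_ / _) (det2 u y0 / _) uy yw => p q; rewrite {}wE => uy /unitc uq.
  have up : gaussunit (1 * q - 0 * p) by apply: unitc; rewrite -uE.
  have {}up : gaussunit q by move: up; rewrite mul0r mul1r subr0.
  exists ((p * -1 - q * -1) / - q); first by apply: quot => //; exact: gaussunitN.
  rewrite -[in LHS](laxZ q^-1); last exact: gaussunitV.
  congr lax; rewrite scalerDr !scalerA mulVf ?gaussunit_neq0 //; congr (_ *: _ + _).
  by field; exact: gaussunit_neq0.
(* For z both coordinates are units, and g = q / p. *)
have [g ug Ez] : exists2 g, gaussunit g & z = lax (1 *: u + g *: v).
  have [[z0 _ Ez] _ _] := zu; rewrite Ez (det2_coord u v z0 d0) in zu zv *.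
  move: (_ / _) (det2 u z0 / _) zu zv => p q zu zv.
  have uq : gaussunit (p * 0 - q * 1) by apply: unitc; rewrite -uE.
  have up : gaussunit (p * 1 - q * 0) by apply: unitc; rewrite -vE.
  have {}up : gaussunit p by move: up; rewrite mulr0 mulr1 subr0.
  exists (- (p * 0 - q * 1) / p); first by apply: quot => //; exact: gaussunitN.
  rewrite -[in LHS](laxZ p^-1); last exact: gaussunitV.
  congr lax; rewrite scalerDr !scalerA mulVf ?gaussunit_neq0 //; congr (_ + _ *: _).
  by field; exact: gaussunit_neq0.
have eN1 : e <> -1.
  move=> E; move: un; rewrite Ex E subrr scale1r scale0r addr0 /= !inE eqxx.
  by rewrite !orbT.
have fN1 : f <> -1.
  move=> E; move: un; rewrite Ey E subrr scale1r scale0r add0r /= !inE eqxx.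
  by rewrite !(orbT, andbF).
have gN1 : g <> 1.
  move=> E; move: un; rewrite Ez E.
  have -> : lax (1 *: u + 1 *: v) = lax (- u - v).
    rewrite -[RHS](laxZ (-1)); last by apply: gaussunitN; exact: gaussunit1.
    by rewrite scaleN1r opprD !opprK !scale1r.
  by rewrite /= !inE eqxx !(orbT, andbF).
move: xz yz xy; rewrite Ex Ey Ez.
move=> /unitc/normsq_unit Nxz /unitc/normsq_unit Nyz _.
have := unit_triple _ _ _ ue uf ug eN1 fN1 gN1 Nxz Nyz.
have li (k : R[i]) a b : gaussunit k -> a = k *: b -> lax b = lax a.
  by move=> uk ->; rewrite laxZ.
have ui : gaussunit ('i : R[i]) by left; right.
have uN1 : gaussunit (-1 : R[i]) by apply: gaussunitN; exact: gaussunit1.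
have uNi : gaussunit (- 'i : R[i]) by exact: gaussunitN.
case=> [[-> [-> ->]]|[-> [-> ->]]]; [left|right]; split.
(* As w = -u - v, the unit -i takes u + (1 + i)v to v + iw; the units in the other bullets are found
   in the same way. *)
- by apply: (li (- 'i)) => //; apply: row2P; rewrite !mxE; ring: (@mulii R).
- by apply: (li (-1)) => //; apply: row2P; rewrite !mxE; ring: (@mulii R).
- by rewrite scale1r.
- by apply: (li 'i) => //; apply: row2P; rewrite !mxE; ring: (@mulii R).
- by apply: (li (-1)) => //; apply: row2P; rewrite !mxE; ring: (@mulii R).
- by rewrite scale1r scaleNr.
Qed.

Lemma lax_neq_coord u v (p q r s : R[i]) : gaussunit (det2 u v) ->
  0 < normsq (p * s - q * r) -> lax (p *: u + q *: v) != lax (r *: u + s *: v).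
Proof.
move=> ud k0; apply: lax_neq; rewrite det2_comb.
apply: mulf_neq0; last exact: gaussunit_neq0.
by apply/eqP => z0; move: k0; rewrite z0 /normsq /= expr0n addr0 ltxx.
Qed.

(** The parameter [k] treats both chambers at once. In coordinates on u, v, each of the fifteen
    pairs of edges has a nonzero determinant. *)
Lemma standard_uniq u v w (k : R[i]) : k = 'i \/ k = - 'i ->
  zero_sum_superbasis u v w ->
  uniq [:: lax u; lax v; lax w; lax (v + k *: w); lax (w + k *: u); lax (u + k *: v)].
Proof.
move=> Hk [[/lax_basis_det ud _ _] /zero_sumE ->].
have -> : v + k *: (- u - v) = - k *: u + (1 - k) *: v.
  by apply: row2P; rewrite !mxE; ring.
have -> : - u - v + k *: u = (k - 1) *: u + -1 *: v.
  by apply: row2P; rewrite !mxE; ring.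
have -> : u + k *: v = 1 *: u + k *: v by rewrite scale1r.
have -> : lax (- u - v) = lax (-1 *: u + -1 *: v) by rewrite !scaleN1r.
(* Writes the first two labels as 1u + 0v and 0u + 1v, the shape that [lax_neq_coord] expects. *)
rewrite -[X in lax X :: _]scale1r -[X in lax X :: _]addr0.
rewrite -[X in lax (_ + X) :: _](scale0r v).
rewrite -[X in _ :: lax X :: _]scale1r -[X in _ :: lax X :: _]add0r.
rewrite -[X in _ :: lax (X + _) :: _](scale0r u).
apply/uniq6P; do ![split]; apply/eqP; apply: lax_neq_coord => //; clear -Hk;
case: Hk => Hk; rewrite ?Hk ?imaginaryE /normsq /= {Hk}; lra.
Qed.

Lemma left_standard_uniq u v w : zero_sum_superbasis u v w ->
  uniq [:: lax u; lax v; lax w;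
           lax (v + 'i *: w); lax (w + 'i *: u); lax (u + 'i *: v)].
Proof. by apply: standard_uniq; left. Qed.

Lemma right_standard_uniq u v w : zero_sum_superbasis u v w ->
  uniq [:: lax u; lax v; lax w;
           lax (v - 'i *: w); lax (w - 'i *: u); lax (u - 'i *: v)].
Proof. by rewrite -!scaleNr; apply: standard_uniq; right. Qed.

Lemma det2_free u v (p q : R[i]) : det2 u v != 0 -> p *: u + q *: v = 0 -> p = 0.
Proof.
move=> d0 E; have : det2 (p *: u + q *: v) v = p * det2 u v.
  by rewrite /det2 !mxE; ring.
have -> : det2 (p *: u + q *: v) v = 0 by rewrite E /det2 !mxE; ring.
by move/esym/eqP; rewrite mulf_eq0 (negbTE d0) orbF => /eqP.
Qed.

(** For k = i and k = -i these are the pairs that label the left and the right apex. The coefficient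
    of u in the relation is -m + in, whose vanishing already gives m = n = 0. *)
Lemma apex_free u v w (k : R[i]) (m n : int) : k = 'i \/ k = - 'i ->
  zero_sum_superbasis u v w ->
  (w - k *: v) *~ m + ('i *: u + ('i * k) *: v) *~ n = 0 -> m = 0 /\ n = 0.
Proof.
move=> Hk [[/lax_basis_det ud _ _] /zero_sumE ->] E.
have key (M N : R[i]) : M *: (- u - v - k *: v) + N *: ('i *: u + ('i * k) *: v)
    = (- M + 'i * N) *: u + (- (1 + k) * M + 'i * k * N) *: v.
  by apply: row2P; rewrite !mxE; ring.
have zs (a : C2 R) (t : int) : a *~ t = t%:~R *: a by rewrite scaler_int.
move: E; rewrite !zs key => /det2_free E0.
move: (E0 (gaussunit_neq0 _ ud)).
have -> : (m%:~R : R[i]) = Complex m%:~R 0.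
  by rewrite -(rmorph_int (real_complex R)).
have -> : (n%:~R : R[i]) = Complex n%:~R 0.
  by rewrite -(rmorph_int (real_complex R)).
rewrite imaginaryE => /eqP; rewrite eq_complex /= => /andP[/eqP Hm /eqP Hn].
split; apply: (@intr_inj R).
- clear -Hm; lra.
- clear -Hn; lra.
Qed.

End StandardChambers.

(** * Symmetries, walls and corners of a labelled tetrahedron *)

Section Tetrahedra.

Context {R : realType}.
Implicit Types (u v w x y z : laxclass R) (C : chamberset R).

Lemma set3_swap (T : Type) (a b c : T) : [set b; a; c] = [set a; b; c].
Proof. by rewrite (setUC [set b]). Qed.

Lemma set3_rot (T : Type) (a b c : T) : [set b; c; a] = [set a; b; c].
Proof. by rewrite setUC setUA. Qed.

(** The swap and the rotation generate the symmetries that keep the wall u, v, w; with the flip,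
    which moves this wall, they generate all symmetries of the tetrahedron. *)
Lemma tetrahedron_swap u v w x y z :
  tetrahedron v u w y x z = tetrahedron u v w x y z.
Proof.
rewrite /tetrahedron (set3_swap _ u v w) -(set3_rot _ w y x) (set3_swap _ x y w).
by rewrite (set3_rot _ w x y); apply/seteqP; split=> t /=; tauto.
Qed.

Lemma tetrahedron_rot u v w x y z :
  tetrahedron v w u y z x = tetrahedron u v w x y z.
Proof.
rewrite /tetrahedron (set3_rot _ u v w) -(set3_rot _ v z x) -(set3_rot _ w y x).
rewrite (set3_swap _ x z v) (set3_swap _ x y w) (set3_rot _ v x z) (set3_rot _ w x y).
by apply/seteqP; split=> t /=; tauto.
Qed.

Lemma tetrahedron_flip u v w x y z :
  tetrahedron u y z x v w = tetrahedron u v w x y z.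
Proof.
rewrite /tetrahedron (set3_swap _ x y w) (set3_swap _ x z v).
rewrite (set3_rot _ w x y) (set3_rot _ v x z).
by apply/seteqP; split=> t /=; tauto.
Qed.

(** A chamber is a set of walls and has no preferred naming of its edges. This records a choice,
    with base wall u, v, w and with x, y, z opposite to u, v, w respectively. *)
Definition chamber_on C u v w x y z :=
  ultrabasis u v w x y z /\ C = tetrahedron u v w x y z.

Lemma chamber_on_swap C u v w x y z :
  chamber_on C u v w x y z -> chamber_on C v u w y x z.
Proof.
move=> [[un [s1 s2 s3 s4]] ->]; split; last by rewrite tetrahedron_swap.
split.
  case/uniq6P: un => -[] ????? [] ???? [] ??? [] ?? ?; apply/uniq6P.
  by do ![split=> //]; apply: nesym.
by split => //; [exact: superbasis_swap|apply/superbasis_rot/superbasis_swap].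
Qed.

Lemma chamber_on_rot C u v w x y z :
  chamber_on C u v w x y z -> chamber_on C v w u y z x.
Proof.
move=> [[un [s1 s2 s3 s4]] ->]; split; last exact/esym/tetrahedron_rot.
split.
  case/uniq6P: un => -[] ????? [] ???? [] ??? [] ?? ?; apply/uniq6P.
  by do ![split=> //]; apply: nesym.
by split => //; [exact: superbasis_rot|apply/superbasis_rot/superbasis_swap..].
Qed.

Lemma chamber_on_flip C u v w x y z :
  chamber_on C u v w x y z -> chamber_on C u y z x v w.
Proof.
move=> [[un [s1 s2 s3 s4]] ->]; split; last by rewrite tetrahedron_flip.
split.
  case/uniq6P: un => -[] ????? [] ???? [] ??? [] ?? ?; apply/uniq6P.
  by do ![split=> //]; apply: nesym.
by split => //; apply/superbasis_swap/superbasis_rot.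
Qed.

Lemma chamber_on_wall C (W : wallset R) : chamber C -> C W ->
  exists u v w x y z, chamber_on C u v w x y z /\ W = [set u; v; w].
Proof.
move=> [u [v [w [x [y [z K]]]]]].
have : chamber_on C u v w x y z by [].
have [_ ->] := K; move=> {}K [[[]|]|] ->.
- by exists u, v, w, x, y, z.
- by exists u, y, z, x, v, w; split=> //; exact: chamber_on_flip.
- exists v, z, x, y, w, u; split; last by rewrite -set3_rot set3_swap set3_rot.
  exact/chamber_on_flip/chamber_on_rot.
- exists w, x, y, z, u, v; split => //.
  exact/chamber_on_flip/chamber_on_rot/chamber_on_rot.
Qed.

(** Lets two chambers with a common wall be named with the same base u, v, w in the same order:
    swaps and rotations realize all six permutations of the base. *)
Lemma chamber_on_relabel C u v w u' v' w' x' y' z' :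
  chamber_on C u' v' w' x' y' z' -> uniq [:: u; v; w] ->
  [set u'; v'; w'] = [set u; v; w] -> exists x y z, chamber_on C u v w x y z.
Proof.
move=> K /uniq3P[ne1 ne2 ne3] E.
have : [set u'; v'; w'] u by rewrite E; left; left.
have : [set u'; v'; w'] v by rewrite E; left; right.
have : [set u'; v'; w'] w by rewrite E; right.
move=> {E} [[]|] ew [[]|] ev [[]|] eu; rewrite ?eu ?ev ?ew // in ne1 ne2 ne3 *.
- by exists z', y', x'; exact/chamber_on_swap/chamber_on_rot.
- by exists y', z', x'; exact: chamber_on_rot.
- by exists z', x', y'; exact/chamber_on_rot/chamber_on_rot.
- by exists x', z', y'; exact/chamber_on_swap/chamber_on_rot/chamber_on_rot.
- by exists y', x', z'; exact: chamber_on_swap.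
- by exists x', y', z'.
Qed.

Lemma edges_tetrahedron u v w x y z :
  edges (tetrahedron u v w x y z) = [set u; v; w; x; y; z].
Proof.
apply/seteqP; split=> t.
  by case=> W [[[|]|]|] -> /=; tauto.
case=> [[[[[]|]|]|]|] ->.
- by exists [set u; v; w]; [do 3 left|left; left].
- by exists [set u; v; w]; [do 3 left|left; right].
- by exists [set u; v; w]; [do 3 left|right].
- by exists [set w; x; y]; [right|left; right].
- by exists [set w; x; y]; [right|right].
- by exists [set u; y; z]; [left; left; right|right].
Qed.

Lemma corner_opposite u v w x y z : uniq [:: u; v; w; x; y; z] ->
  edges (tetrahedron u v w x y z) `\` [set u; v; w] = [set x; y; z].
Proof.
move=> /uniq6P[] [] ????? [] ???? [] ??? [] ?? ?; rewrite edges_tetrahedron; apply/seteqP; split=> t /=.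
  by tauto.
by move=> [[]|] ->; split; tauto || (move=> [[]|]; congruence).
Qed.

Lemma corner_chamber_on C V : chamber C -> corner C V ->
  exists u v w x y z, chamber_on C u v w x y z /\ V = [set x; y; z].
Proof.
move=> ch [W CW ->]; have [u [v [w [x [y [z [K ->]]]]]]] := chamber_on_wall _ _ ch CW.
exists u, v, w, x, y, z; split => //.
by have [[un _] ->] := K; exact: corner_opposite.
Qed.

(** Each wall is moved to the base by flips and rotations, and the corner is then the opposite
    triple. The labels are listed in the order used by [corner_label]. *)
Lemma chamber_on_corner C u v w x y z V : chamber_on C u v w x y z -> corner C V ->
  [\/ V = [set z; x; y], V = [set v; w; x], V = [set w; u; y] | V = [set u; v; z]].
Proof.
move=> K [W CW ->]; have [_ EC] := K.
have opp u' v' w' x' y' z' : chamber_on C u' v' w' x' y' z' ->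
    edges C `\` [set u'; v'; w'] = [set x'; y'; z'].
  by move=> [[un _] ->]; exact: corner_opposite.
have /opp opp1 := chamber_on_flip _ _ _ _ _ _ _ K.
have /opp opp2 := chamber_on_flip _ _ _ _ _ _ _ (chamber_on_rot _ _ _ _ _ _ _ K).
have /opp opp3 := chamber_on_flip _ _ _ _ _ _ _
  (chamber_on_rot _ _ _ _ _ _ _ (chamber_on_rot _ _ _ _ _ _ _ K)).
move: CW; rewrite {1}EC => -[[[]|]|] ->.
- by apply: Or41; rewrite (opp _ _ _ _ _ _ K) set3_rot.
- by apply: Or42; rewrite opp1 -set3_rot.
- by apply: Or43; rewrite setUAC opp2 -set3_rot.
- by apply: Or44; rewrite opp3 -set3_rot.
Qed.

End Tetrahedra.

(** * Real and imaginary parts of the form, and norms of lax vectors *)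

Section HermitianValues.

Context {R : realType} (h : C2 R -> C2 R -> R[i]) (hh : hermitian_form h).
Implicit Types (a b u v w : C2 R) (l x y z : laxclass R) (C : chamberset R).

Notation reh a b := (complex.Re (h a b)).
Notation imh := (imform h).

Lemma hermDl a b c : h (a + b) c = h a c + h b c.
Proof. by case: hh => H _ _; have := H 1 a b c; rewrite scale1r mul1r. Qed.

Lemma hermDr a b c : h c (a + b) = h c a + h c b.
Proof. by case: hh => _ H _; have := H 1 c a b; rewrite scale1r conjC1 mul1r. Qed.

Lemma hermZl k a b : h (k *: a) b = k * h a b.
Proof.
have h0 : h 0 b = 0 by have /eqP := hermDl 0 0 b; rewrite addr0 addrC -subr_eq subrr => /eqP.
by case: hh => H _ _; have := H k a 0 b; rewrite addr0 h0 addr0.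
Qed.

Lemma rehC a b : reh b a = reh a b.
Proof. by case: hh => _ _ H; rewrite (H b a); case: (h a b). Qed.

Lemma imhC a b : imh b a = - imh a b.
Proof. by case: hh => _ _ H; rewrite /imform (H b a); case: (h a b). Qed.

Lemma imhaa a : imh a a = 0.
Proof. by have := imhC a a; lra. Qed.

Lemma rehDl a b c : reh (a + b) c = reh a c + reh b c.
Proof. by rewrite hermDl; case: (h a c); case: (h b c). Qed.

Lemma rehDr a b c : reh c (a + b) = reh c a + reh c b.
Proof. by rewrite hermDr; case: (h c a); case: (h c b). Qed.

Lemma imhDl a b c : imh (a + b) c = imh a c + imh b c.
Proof. by rewrite /imform hermDl; case: (h a c); case: (h b c). Qed.

Lemma imhDr a b c : imh c (a + b) = imh c a + imh c b.
Proof. by rewrite /imform hermDr; case: (h c a); case: (h c b). Qed.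

Lemma rehNl a b : reh (- a) b = - reh a b.
Proof. by rewrite -scaleN1r hermZl mulN1r; case: (h a b). Qed.

Lemma rehNr a b : reh a (- b) = - reh a b.
Proof. by rewrite rehC rehNl rehC. Qed.

Lemma imhNl a b : imh (- a) b = - imh a b.
Proof. by rewrite /imform -scaleN1r hermZl mulN1r; case: (h a b). Qed.

Lemma imhNr a b : imh a (- b) = - imh a b.
Proof. by rewrite imhC imhNl opprK imhC. Qed.

Lemma rehil a b : reh ('i *: a) b = - imh a b.
Proof. by rewrite /imform hermZl imaginaryE; case: (h a b) => p q /=; ring. Qed.

Lemma imhil a b : imh ('i *: a) b = reh a b.
Proof. by rewrite /imform hermZl imaginaryE; case: (h a b) => p q /=; ring. Qed.

Lemma rehir a b : reh a ('i *: b) = imh a b.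
Proof. by rewrite rehC rehil imhC opprK. Qed.

Lemma imhir a b : imh a ('i *: b) = - reh a b.
Proof. by rewrite imhC imhil rehC. Qed.

Definition hermE := (rehDl, rehDr, imhDl, imhDr, rehNl, rehNr, imhNl, imhNr,
  rehil, rehir, imhil, imhir).

(** Im h is bilinear over the integers and alternating, so a change of basis multiplies it by the
    determinant. *)
Lemma imhMz a b (p q r s : int) :
  imh (a *~ p + b *~ q) (a *~ r + b *~ s) = (p * s - q * r)%:~R * imh a b.
Proof.
have zl c d (t : int) : imh (c *~ t) d = t%:~R * imh c d.
  rewrite -scaler_int /imform hermZl -(rmorph_int (real_complex R)).
  by case: (h c d) => e f /=; ring.
have zr c d (t : int) : imh d (c *~ t) = t%:~R * imh d c.
  by rewrite imhC zl imhC mulrN opprK.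
rewrite !imhDl !imhDr !zl !zr !imhaa (imhC a b) !(rmorphB, rmorphM) /=; ring.
Qed.

(** Compatible bases differ by determinant 1, and passing from L to iL costs the factor i times its
    conjugate, which is 1. *)
Lemma compatible_imform a0 b0 a b :
  compatible (lax_lattice a0 b0) a b -> imh a b = imh a0 b0.
Proof.
move=> [_ [->|->] [_ [p [q [r [s [/= E -> ->]]]]]]]; rewrite imhMz E mul1r //.
by rewrite imhil rehir.
Qed.

(** The q of the introduction, computed on an arbitrary representative; [laxnormE] shows that the
    choice does not matter. *)
Definition laxnorm l : R := let v := xget 0 l in reh v v.

Lemma laxnormE v : laxnorm (lax v) = reh v v.
Proof.
rewrite /laxnorm; have : lax v (xget 0 (lax v)) by apply: xgetI; exact: lax_self.
move=> [e ue <-]; case: ue => [[[]|]|] ->;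
by rewrite ?scaleNr ?scale1r ?hermE ?opprK.
Qed.

Lemma laxnorm_addi a b :
  laxnorm (lax (a + 'i *: b)) = laxnorm (lax a) + laxnorm (lax b) + 2 * imh a b.
Proof. by rewrite !laxnormE !hermE (imhC a b); ring. Qed.

Lemma laxnorm_subi a b :
  laxnorm (lax (a - 'i *: b)) = laxnorm (lax a) + laxnorm (lax b) - 2 * imh a b.
Proof. by rewrite !laxnormE !hermE (imhC a b); ring. Qed.

(** As Im h is alternating, it takes the same value on the three cyclic pairs, which makes the
    correction term of a standard chamber symmetric in u, v, w. *)
Lemma zero_sum_values u v w : u + v + w = 0 ->
  [/\ laxnorm (lax w) = laxnorm (lax u) + laxnorm (lax v) + 2 * reh u v,
      imh v w = imh u v & imh w u = imh u v].
Proof.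
move=> /zero_sumE ->; rewrite !laxnormE !hermE !imhaa (rehC v u) (imhC u v).
by split; ring.
Qed.

(** * Norm sums over walls and corners, and the value of a corner *)

Definition laxsum (A : set (laxclass R)) : R := \sum_(l \in A) laxnorm l.

Lemma laxsumU1 (A : set (laxclass R)) l : finite_set A -> ~ A l ->
  laxsum (A `|` [set l]) = laxsum A + laxnorm l.
Proof.
move=> fA Al; rewrite /laxsum fsbigU0 ?fsbig_set1 //.
by move=> t [At tl]; apply: Al; rewrite -tl.
Qed.

Lemma laxsum1 x : laxsum [set x] = laxnorm x.
Proof. exact: fsbig_set1. Qed.

Lemma laxsum2 x y : x <> y -> laxsum [set x; y] = laxnorm x + laxnorm y.
Proof.
move=> xy; rewrite laxsumU1 ?laxsum1 //.
by move=> /esym.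
Qed.

Lemma laxsum3 x y z : x <> y -> x <> z -> y <> z ->
  laxsum [set x; y; z] = laxnorm x + laxnorm y + laxnorm z.
Proof.
move=> xy xz yz; rewrite laxsumU1 ?laxsum2 //.
by move=> [] /esym.
Qed.

Lemma laxsum6 (u v w x y z : laxclass R) : uniq [:: u; v; w; x; y; z] ->
  laxsum [set u; v; w; x; y; z] =
  laxnorm u + laxnorm v + laxnorm w + laxnorm x + laxnorm y + laxnorm z.
Proof.
move=> /uniq6P[] [] ????? [] ???? [] ??? [] ?? ?.
by rewrite !laxsumU1 ?laxsum1 //=; intuition congruence.
Qed.

(* In a chamber, the norms of two opposite edges have a sum S that does not
   depend on the pair, so that [laxsum (edges C) = 3 S], and H of the corner [V]
   is [(laxsum V - S) / 2]. *)
Definition corner_value C (V : cornerset R) : R :=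
  laxsum V / 2 - laxsum (edges C) / 6.

Lemma corner_value_tetrahedron (u v w x y z : laxclass R) V :
  uniq [:: u; v; w; x; y; z] ->
  corner_value (tetrahedron u v w x y z) V = laxsum V / 2 -
  (laxnorm u + laxnorm v + laxnorm w + laxnorm x + laxnorm y + laxnorm z) / 6.
Proof. by move=> un; rewrite /corner_value edges_tetrahedron laxsum6. Qed.

Lemma corner_value_base (u v w x y z : laxclass R) :
  uniq [:: u; v; w; x; y; z] ->
  let T := laxnorm u + laxnorm v + laxnorm w + laxnorm x + laxnorm y + laxnorm z in
  [/\ corner_value (tetrahedron u v w x y z) [set u; v; z] =
        (laxnorm u + laxnorm v + laxnorm z) / 2 - T / 6,
      corner_value (tetrahedron u v w x y z) [set v; w; x] =
        (laxnorm v + laxnorm w + laxnorm x) / 2 - T / 6,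
      corner_value (tetrahedron u v w x y z) [set w; u; y] =
        (laxnorm w + laxnorm u + laxnorm y) / 2 - T / 6 &
      corner_value (tetrahedron u v w x y z) [set z; x; y] =
        (laxnorm z + laxnorm x + laxnorm y) / 2 - T / 6].
Proof.
move=> un T; rewrite !corner_value_tetrahedron //.
case/uniq6P: un => -[] ????? [] ???? [] ??? [] ?? ?.
by rewrite !laxsum3 //; exact: nesym.
Qed.

Lemma corner_label_imform C V Lam a b :
  corner_label C V Lam -> compatible Lam a b -> imh a b = corner_value C V.
Proof.
case=> {C V Lam} u v w zs /compatible_imform ->;
  have [_ z0] := zs; have [Ew Ei Ej] := zero_sum_values _ _ _ z0;
  have [L1 L2 L3 L4] := corner_value_base _ _ _ _ _ _ (left_standard_uniq _ _ _ zs);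
  have [R1 R2 R3 R4] := corner_value_base _ _ _ _ _ _ (right_standard_uniq _ _ _ zs);
  [rewrite L1|rewrite L2|rewrite L3|rewrite L4
  |rewrite R1|rewrite R2|rewrite R3|rewrite R4];
  (* Everything is reduced to q(u), q(v) and the real and imaginary parts of h(u, v), in which the
     eight identities are linear. *)
  rewrite ?laxnorm_addi ?laxnorm_subi Ew ?Ei ?Ej ?(zero_sumE _ _ _ z0) !hermE ?laxnormE ?imhaa;
  have Cr := rehC u v; have Ci := imhC u v; clear -Cr Ci; lra.
Qed.

(** The number [e] records the handedness: 2 on the left, -2 on the right. Each pair of opposite
    edges then has norm sum S + e H(u, v). *)
Lemma chamber_on_laxnorm C u v w (x y z : laxclass R) : zero_sum_superbasis u v w ->
  chamber_on C (lax u) (lax v) (lax w) x y z ->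
  let S := laxnorm (lax u) + laxnorm (lax v) + laxnorm (lax w) in
  exists e : R,
   [/\ e = 2 /\ C = left_standard u v w \/ e = -2 /\ C = right_standard u v w,
      laxnorm x = S - laxnorm (lax u) + e * imh u v,
      laxnorm y = S - laxnorm (lax v) + e * imh u v &
      laxnorm z = S - laxnorm (lax w) + e * imh u v].
Proof.
move=> zs [ub EC] S; have [_ z0] := zs; have [_ Ei Ej] := zero_sum_values _ _ _ z0.
have [[Ex Ey Ez]|[Ex Ey Ez]] := ultrabasis_standard _ _ _ _ _ _ zs ub.
- exists 2; rewrite EC Ex Ey Ez; split; first by left.
  + by rewrite laxnorm_addi Ei /S; ring.
  + by rewrite laxnorm_addi Ej /S; ring.
  + by rewrite laxnorm_addi /S; ring.
- exists (-2); rewrite EC Ex Ey Ez; split; first by right.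
  + by rewrite laxnorm_subi Ei /S; ring.
  + by rewrite laxnorm_subi Ej /S; ring.
  + by rewrite laxnorm_subi /S; ring.
Qed.

Lemma chamber_on_opposite C (u v w x y z : laxclass R) : chamber_on C u v w x y z ->
  laxnorm u + laxnorm x = laxnorm v + laxnorm y /\
  laxnorm u + laxnorm x = laxnorm w + laxnorm z.
Proof.
move=> K; have [[_ [sb _ _ _]] _] := K.
have [u0 [v0 [w0 [Eu Ev Ew zs]]]] := superbasis_zero_sum _ _ _ sb; subst u v w.
by have [e [_ -> -> ->]] := chamber_on_laxnorm _ _ _ _ _ _ _ zs K; split; ring.
Qed.

(** The right-hand side involves only the wall and the edges of the wall through the vertex, which
    is exactly what gluing preserves. It has the form (q(a) + q(b) - q(c)) / 2, and the equal sums
    of opposite edges make it the same for the three walls through [V]. *)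
Lemma corner_value_wall C V (W : wallset R) : chamber C -> corner C V -> C W ->
  on_wall V W -> corner_value C V = laxsum (V `&` W) - laxsum W / 2.
Proof.
move=> ch co CW [t [Vt Wt]].
have [u [v [w [x [y [z [K EV]]]]]]] := corner_chamber_on _ _ ch co; subst V.
have [Exy Exz] := chamber_on_opposite _ _ _ _ _ _ _ K.
have [[un _] EC] := K; rewrite EC corner_value_tetrahedron // in CW *.
move: un => /uniq6P[] [] ????? [] ???? [] ??? [] ?? ?.
rewrite laxsum3 //; case: CW Wt => [[[]|]|] -> Wt.
- by exfalso; move: Vt Wt => /=; intuition congruence.
- have -> : [set x; y; z] `&` [set u; y; z] = [set y; z].
    by apply/seteqP; split=> s /=; intuition congruence.
  rewrite laxsum2 // laxsum3 //; clear -Exy Exz; lra.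
- have -> : [set x; y; z] `&` [set v; x; z] = [set x; z].
    by apply/seteqP; split=> s /=; intuition congruence.
  rewrite laxsum2 // laxsum3 //; clear -Exy Exz; lra.
- have -> : [set x; y; z] `&` [set w; x; y] = [set x; y].
    by apply/seteqP; split=> s /=; intuition congruence.
  rewrite laxsum2 // laxsum3 //; clear -Exy Exz; lra.
Qed.

(** * From corners to vertices of the glued kingdom *)

Lemma corner_value_glued p q : glued p q -> corner_value p.1 p.2 = corner_value q.1 q.2.
Proof.
move=> [cp cq kp kq [W [pW qW on E]]].
rewrite (corner_value_wall _ _ W) // (corner_value_wall q.1 q.2 W) ?E //.
by move: on; rewrite /on_wall E.
Qed.

Lemma corner_value_point C V q : point_of C V q -> corner_value C V = corner_value q.1 q.2.
Proof.
rewrite /point_of /= => H; suff : corner_value (C, V).1 (C, V).2 = corner_value q.1 q.2 by [].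
by elim: H => [p r /corner_value_glued|p|p r _ ->|p r s _ -> _ ->].
Qed.

(** [vertex_value] quantifies over all labels, so uniqueness of the value requires that a label with
    a compatible basis exists. Every corner is the apex over its opposite wall, so the apex labels
    suffice. *)
Lemma corner_labelled C V : chamber C -> corner C V ->
  exists Lam a b, corner_label C V Lam /\ compatible Lam a b.
Proof.
move=> ch co; have [u [v [w [x [y [z [K ->]]]]]]] := corner_chamber_on _ _ ch co.
have [ub EC] := K; have [_ [sb _ _ _]] := ub.
have [u0 [v0 [w0 [Eu Ev Ew zs]]]] := superbasis_zero_sum _ _ _ sb; subst u v w.
have comp a b : (forall m n : int, a *~ m + b *~ n = 0 -> m = 0 /\ n = 0) ->
    compatible (lax_lattice a b) a b.
  move=> free; exists (oriented_by a b); first by left.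
  split=> //=; exists 1, 0, 0, 1; split=> //.
  - by rewrite mulr1z mulr0z addr0.
  - by rewrite mulr1z mulr0z add0r.
have [[Ex Ey Ez]|[Ex Ey Ez]] := ultrabasis_standard _ _ _ _ _ _ zs ub.
- do 3 eexists; split; first by rewrite EC Ex Ey Ez set3_rot; exact: left_apex.
  apply: comp => m n E; apply: (apex_free u0 v0 w0 'i m n) => //; first by left.
  by rewrite -[RHS]E mulii scaleN1r.
- do 3 eexists; split; first by rewrite EC Ex Ey Ez set3_rot; exact: right_apex.
  apply: comp => m n E; apply: (apex_free u0 v0 w0 (- 'i) m n) => //; first by right.
  by rewrite -[RHS]E mulrN mulii opprK scale1r scaleNr opprK.
Qed.

Lemma vertex_value_point C V r : chamber C -> corner C V ->
  vertex_value h (point_of C V) r <-> r = corner_value C V.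
Proof.
move=> ch co; split=> [H|-> Lam a b [D [U [XDU lab]]] comp].
  have [Lam [a [b [lab comp]]]] := corner_labelled _ _ ch co.
  rewrite -(corner_label_imform _ _ _ _ _ lab comp); apply/esym/H; last exact: comp.
  by exists C, V; split=> //; exact: rst_refl.
by rewrite (corner_label_imform _ _ _ _ _ lab comp) (corner_value_point _ _ _ XDU).
Qed.

Lemma HvertexE C V : chamber C -> corner C V ->
  Hvertex h (point_of C V) = corner_value C V.
Proof.
move=> ch co; apply: xget_unique => [|r]; first exact/(vertex_value_point _ _ _ ch co).
by move/(vertex_value_point _ _ _ ch co).
Qed.

End HermitianValues.

Theorem theorem1p3 (R : realType) (h : C2 R -> C2 R -> R[i])
    (hh : hermitian_form h) :
  (forall X : kingdom_point R, kingdom_vertex X ->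
     exists! r : R, vertex_value h X r)
  /\
  (forall (C D : chamberset R) (W : wallset R)
          (X1 X2 X3 Y1 Y2 : cornerset R),
     chamber C -> chamber D -> C <> D -> C W -> D W ->
     [/\ corner C X1, corner C X2 & corner C X3] ->
     [/\ X1 <> X2, X2 <> X3 & X1 <> X3] ->
     [/\ on_wall X1 W, on_wall X2 W & on_wall X3 W] ->
     corner C Y1 -> ~ on_wall Y1 W ->
     corner D Y2 -> ~ on_wall Y2 W ->
     Hvertex h (point_of C Y1) + Hvertex h (point_of D Y2) =
     2 * (Hvertex h (point_of C X1) + Hvertex h (point_of C X2)
          + Hvertex h (point_of C X3))).
Proof.
split=> [_ [C [V [ch co ->]]]|].
  exists (corner_value h C V); split; first exact/vertex_value_point.
  by move=> r /(vertex_value_point h hh _ _ _ ch co).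
move=> C D W X1 X2 X3 Y1 Y2 chC chD neCD CW DW [c1 c2 c3] nX [o1 o2 o3] cY1 nY1 cY2 nY2.
rewrite !(HvertexE h hh) //.
have [u [v [w [x [y [z [KC EW]]]]]]] := chamber_on_wall _ _ chC CW; subst W.
have [u' [v' [w' [x' [y' [z' [KD /esym EW]]]]]]] := chamber_on_wall _ _ chD DW.
have [[unC [sb _ _ _]] EC] := KC.
have un3 : uniq [:: u; v; w] by case/uniq6P: unC => -[] ????? [] ???? _ _ _; apply/uniq3P.
have {x' y' z' KD EW} [x' [y' [z' KD]]] := chamber_on_relabel _ _ _ _ _ _ _ _ _ _ KD un3 EW.
have [[unD _] ED] := KD.
have [u0 [v0 [w0 [Eu Ev Ew zs]]]] := superbasis_zero_sum _ _ _ sb; subst u v w.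
have [e [eC Cx Cy Cz]] := chamber_on_laxnorm h hh _ _ _ _ _ _ _ zs KC.
have [f [fD Dx Dy Dz]] := chamber_on_laxnorm h hh _ _ _ _ _ _ _ zs KD.
(* Two different chambers on the same wall have opposite handedness. *)
have ef : e + f = 0.
  by case: eC fD => -[-> E] [] [-> F]; rewrite ?subrr ?addNr //; case: neCD; rewrite E F.
have apex E a b c : chamber_on E (lax u0) (lax v0) (lax w0) a b c -> forall Y, corner E Y ->
    ~ on_wall Y [set lax u0; lax v0; lax w0] -> Y = [set c; a; b].
  move=> KE Y cY nY; case: (chamber_on_corner _ _ _ _ _ _ _ _ KE cY) => // EY; case: nY.
  - by exists (lax v0); rewrite EY; split; [do 2 left|left; right].
  - by exists (lax w0); rewrite EY; split; [do 2 left|right].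
  - by exists (lax u0); rewrite EY; split; do 2 left.
have -> := apex _ _ _ _ KC _ cY1 nY1.
have -> := apex _ _ _ _ KD _ cY2 nY2.
have base Y : corner C Y -> on_wall Y [set lax u0; lax v0; lax w0] ->
    [\/ Y = [set lax v0; lax w0; x], Y = [set lax w0; lax u0; y] |
        Y = [set lax u0; lax v0; z]].
  move=> cY [t [Yt Wt]]; case: (chamber_on_corner _ _ _ _ _ _ _ _ KC cY) => EY.
  - exfalso; move: Yt Wt; rewrite EY.
    by case/uniq6P: unC => -[] ????? [] ???? [] ??? [] ?? ?; move=> /=; intuition congruence.
  - by apply: Or31.
  - by apply: Or32.
  - by apply: Or33.
(* Being distinct, X1, X2, X3 are the three corners of the base in some order. *)
have -> : corner_value h C X1 + corner_value h C X2 + corner_value h C X3 =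
    corner_value h C [set lax v0; lax w0; x] + corner_value h C [set lax w0; lax u0; y]
    + corner_value h C [set lax u0; lax v0; z].
  case: nX; case: (base _ c1 o1) => ->; case: (base _ c2 o2) => ->;
    case: (base _ c3 o3) => -> // *; ring.
rewrite EC ED; have [-> -> -> ->] := corner_value_base h _ _ _ _ _ _ unC.
have [_ _ _ ->] := corner_value_base h _ _ _ _ _ _ unD.
rewrite Cx Cy Cz Dx Dy Dz.
(* The two apex values are Q / 2 + e H(u, v) and Q / 2 + f H(u, v), with Q the norm sum of the wall,
   so the handedness terms cancel. *)
have -> : f = - e by clear -ef; lra.
clear; lra.
Qed.
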